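(* Suppose that for a.a. $x_1,x_2,y_1\in\mathbb{R}^d$ $$\tilde c(x_1,x_2,y_1)=\tilde c(\{x_1,x_2\},y_1):=\int_{\mathbb{R}^d}c(x_1,x_2,y_1,y_2)\,dy_2<\infty .$$ Then, for any $G\in B_{\mathrm{bs}}(\Gamma_0)$, the following formula holds: $$(\widehat L G)(\eta)=(L_0G)(\eta)+(WG)(\eta),$$ where $$(L_0G)(\eta)=\sum_{\{x_1,x_2\}\subset\eta}\int_{\mathbb{R}^d}\int_{\mathbb{R}^d}c(x_1,x_2,y_1,y_2)\bigl(G(\eta\setminus\{x_1,x_2\}\cup\{y_1,y_2\})-G(\eta)\bigr)\,dy_1dy_2,$$ $$(WG)(\eta)=\sum_{x_2\in\eta}\ \sum_{x_1\in\eta\setminus\{x_2\}}\int_{\mathbb{R}^d}\tilde c(x_1,x_2,y_1)\bigl(G((\eta\setminus\{x_1,x_2\})\cup\{y_1\})-G(\eta\setminus\{x_2\})\bigr)\,dy_1 .$$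
   Context: $d\in\mathbb{N}$. $\Gamma$ is the set of all locally finite subsets $\gamma$ of $\mathbb{R}^d$. $\Gamma_0=\bigsqcup_{n\ge0}\Gamma^{(n)}$ is the set of all finite subsets $\eta$ of $\mathbb{R}^d$, where $\Gamma^{(n)}$ is the set of $n$-point subsets, identified with the quotient of $\{(x_1,\dots,x_n)\in(\mathbb{R}^d)^n: x_k\ne x_l\text{ for }k\neq l\}$ by the permutation group $S_n$, with the corresponding Borel $\sigma$-algebra. $B_{\mathrm{bs}}(\Gamma_0)$ is the set of bounded measurable $G:\Gamma_0\to\mathbb{R}$ with bounded support, i.e. vanishing outside $\bigsqcup_{n=0}^N\{\eta\subset\Lambda:|\eta|=n\}$ for some $N\in\mathbb{N}$ and some bounded Borel $\Lambda\subset\mathbb{R}^d$. The rate $c:(\mathbb{R}^d)^4\to[0,\infty)$ is measurable, depends only on the unordered pairs $\{x_1,x_2\}$ and $\{y_1,y_2\}$, i.e. $c(x_1,x_2,y_1,y_2)=c(x_2,x_1,y_1,y_2)=c(x_1,x_2,y_2,y_1)$, and satisfies $c(x_1,x_2,\cdot,\cdot)\in L^1_{\mathrm{loc}}(\mathbb{R}^d\times\mathbb{R}^d)$ for a.a. $x_1,x_2\in\mathbb{R}^d$. The (informal) generator of binary jumps is $$(LF)(\gamma)=\sum_{\{x_1,x_2\}\subset\gamma}\int_{\mathbb{R}^d}\int_{\mathbb{R}^d}c(x_1,x_2,y_1,y_2)\bigl(F(\gamma\setminus\{x_1,x_2\}\cup\{y_1,y_2\})-F(\gamma)\bigr)\,dy_1dy_2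 ,$$ considered here at finite configurations $\gamma$. The $K$-transform is $(KG)(\gamma)=\sum_{\eta\subset\gamma,\,|\eta|<\infty}G(\eta)$, with inverse $(K^{-1}F)(\eta)=\sum_{\xi\subset\eta}(-1)^{|\eta\setminus\xi|}F(\xi)$ for $\eta\in\Gamma_0$ (defined for any $F$ given at least on $\Gamma_0$). Finally $(\widehat LG)(\eta):=(K^{-1}LKG)(\eta)$, $\eta\in\Gamma_0$.
   Formalization: The formula is claimed at each η where the integrals in (LKG)(γ) for γ ⊂ η, in (L_0G)(η) and in (WG)(η) converge absolutely; under the stated hypotheses alone these integrals may diverge and, for instance, (WG)(η) may be ∞ − ∞. *)

(* Defs.v *)
From HB Require Import structures.
From mathcomp Require Import all_boot all_order all_algebra finmap.
From mathcomp Require Import all_classical all_reals all_analysis.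
From mathcomp Require Import measurable_realfun.

Set Implicit Arguments.
Unset Strict Implicit.
Unset Printing Implicit Defensive.

Import Order.TTheory GRing.Theory Num.Theory.
Import numFieldNormedType.Exports.

Local Open Scope classical_set_scope.
Local Open Scope ring_scope.

(* R^d as d-tuples of reals: the library's sigma-algebra on tuples is the one
   generated by the coordinates, i.e. the Borel sigma-algebra of R^d. *)
Notation vec R d := (d.-tuple (measurableTypeR R)).

Section lebesgue_vec.
Context {R : realType}.

Definition consv (d : nat) (z : measurableTypeR R * vec R d) : vec R d.+1 :=
  [tuple of z.1 :: z.2].

(* d-dimensional Lebesgue measure, by R^(d+1) = R x R^d. *)
Fixpoint leb (d : nat) : set (vec R d) -> \bar R :=
  match d with
  | 0 => dirac [tuple]
  | d'.+1 => pushforward (@lebesgue_measure R \x @leb d')%E (@consv d')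
  end.

Lemma measurable_consv d : measurable_fun setT (@consv d).
Proof. by apply: (measurable_cons (f := fst) (g := snd)). Qed.

Let sfinite_measure_exists d (mu : set (vec R d) -> \bar R) :
  mu set0 = 0%E -> (forall A, 0 <= mu A)%E -> semi_sigma_additive mu ->
  sigma_finite setT mu ->
  exists m : {sigma_finite_measure set (vec R d) -> \bar R}, mu = m.
Proof.
move=> mu0 mu_ge0 mu_add sf.
pose muB := isMeasure.Build _ _ _ mu mu0 mu_ge0 mu_add.
pose muM : {measure set _ -> \bar R} := HB.pack mu muB.
pose muS : {sigma_finite_measure set _ -> \bar R} :=
  HB.pack mu muM (Measure_isSigmaFinite.Build _ _ _ muM sf).
by exists muS.
Qed.

Let leb_measure_sfinite d :
  exists m : {sigma_finite_measure set (vec R d) -> \bar R}, leb (d := d) = m.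
Proof.
elim: d => [|d [m Em]].
  by exists (@dirac _ (vec R 0) [tuple] R : {sigma_finite_measure set _ -> \bar R}).
pose lm : {measure set (measurableTypeR R * vec R d)%type -> \bar R} :=
  (@lebesgue_measure R \x m)%E.
pose mu := pushforward lm (@consv d).
have mc := @measurable_consv d.
have mu0 : mu set0 = 0%E by rewrite /mu /pushforward preimage_set0 measure0.
have mu_ge0 A : (0 <= mu A)%E by exact: measure_ge0.
have mu_add : semi_sigma_additive mu.
  move=> F mF tF mUF; rewrite /mu /pushforward preimage_bigcup.
  apply: measure_semi_sigma_additive.
  - by move=> n; rewrite -[X in measurable X]setTI; exact: mc.
  - apply/trivIsetP => /= i j _ _ ij; rewrite -preimage_setI.
    by move/trivIsetP : tF => /(_ _ _ _ _ ij) ->//; rewrite preimage_set0.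
  - by rewrite -preimage_bigcup -[X in measurable X]setTI; exact: mc.
have sf : sigma_finite setT mu.
  have /sigma_finiteP[F [FT ndF Foo]] := sigma_finiteT (@lebesgue_measure R).
  have /sigma_finiteP[H [HT ndH Hoo]] := sigma_finiteT m.
  pose u (t : vec R d.+1) : measurableTypeR R * vec R d :=
    (thead t, [tuple of behead t]).
  have mu_ : measurable_fun setT u.
    by apply: measurable_fun_pair; [exact: measurable_tnth|exact: measurable_behead].
  exists (fun n => u @^-1` (F n `*` H n)).
    apply/esym/seteqP; split=> // t _.
    have [n _ Fn] : (\bigcup_n F n) (u t).1 by rewrite -FT.
    have [k _ Hk] : (\bigcup_n H n) (u t).2 by rewrite -HT.
    exists (maxn n k) => //; split.
    - by move: Fn; exact/subsetPset/ndF/leq_maxl.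
    - by move: Hk; exact/subsetPset/ndH/leq_maxr.
  move=> i; have [mF Fi] := Foo i; have [mH Hi] := Hoo i; split.
    by rewrite -[X in measurable X]setTI; apply: mu_ => //; exact: measurableX.
  rewrite /mu /pushforward -comp_preimage.
  have -> : u \o @consv d = id.
    apply/funext => -[a t]; rewrite /u /consv /=; congr pair.
    exact/val_inj.
  rewrite preimage_id /lm /= product_measure1E//.
  by rewrite lte_mul_pinfty// ge0_fin_numE.
by rewrite /= Em; exact: sfinite_measure_exists.
Qed.

Section instances.
Variable d : nat.
Local Notation mu := (leb (d := d)).

Let leb0 : mu set0 = 0%E.
Proof. by have [m ->] := leb_measure_sfinite d; rewrite measure0. Qed.

Let leb_ge0 A : (0 <= mu A)%E.
Proof. by have [m ->] := leb_measure_sfinite d; exact: measure_ge0. Qed.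

Let leb_sigma_additive : semi_sigma_additive mu.
Proof.
by have [m ->] := leb_measure_sfinite d; exact: measure_semi_sigma_additive.
Qed.

HB.instance Definition _ :=
  isMeasure.Build _ _ _ mu leb0 leb_ge0 leb_sigma_additive.

Let leb_sigma_finite : sigma_finite setT mu.
Proof. by have [m ->] := leb_measure_sfinite d; exact: sigma_finiteT. Qed.

HB.instance Definition _ :=
  Measure_isSigmaFinite.Build _ _ _ mu leb_sigma_finite.

End instances.

Definition vbounded (d : nat) (A : set (vec R d)) :=
  exists M : R, forall x, A x -> forall i, `|tnth x i : R| <= M.

End lebesgue_vec.
Arguments leb {R d}.

(* The space Gamma_0 of finite configurations. *)
Definition conf (R : realType) (d : nat) := {fset vec R d}.
HB.instance Definition _ R d := Pointed.on (conf R d).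

Definition conf_display : measure_display. Proof. exact: default_measure_display. Qed.

Section conf_measurable.
Context {R : realType} {d : nat}.

(* [conf_of] restricted to [offdiag] is the quotient map by S_n. *)
Definition offdiag (n : nat) : set (n.-tuple (vec R d)) := [set x | uniq x].
Definition conf_of (n : nat) (x : n.-tuple (vec R d)) : conf R d :=
  [fset y in tval x]%fset.

(* A is measurable iff its preimage under every quotient map is Borel. *)
Definition conf_measurable (A : set (conf R d)) :=
  forall n, measurable (@offdiag n `&` @conf_of n @^-1` A).

Lemma measurable_offdiag n : measurable (@offdiag n).
Proof.
have -> : @offdiag n = \bigcap_(i in [set: 'I_n]) \bigcap_(j in [set j | j != i])
    \bigcup_(k in [set: 'I_d])
      [set x : n.-tuple (vec R d) | tnth (tnth x i) k != tnth (tnth x j) k].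
  apply/seteqP; split => [x /= /tuple_uniqP ux i _ j /= ji|x /= H].
    apply: contrapT => nk; move/eqP: ji; apply; apply: ux; apply/eq_from_tnth => k.
    by apply/eqP; apply: contrapT => /negP nK; apply: nk; exists k => //=; rewrite eq_sym.
  apply/tuple_uniqP => i j xij; apply/eqP; apply: contrapT => /negP ji.
  have [k _ /=] := H j I i ji.
  by rewrite xij eqxx.
apply: fin_bigcap_measurable => // i _.
apply: fin_bigcap_measurable => [|j _]; first exact: finite_finset.
apply: fin_bigcup_measurable => // k _.
have mt (l : 'I_n) : measurable_fun setT
    (fun x : n.-tuple (vec R d) => tnth (tnth x l) k : R).
  apply: (@measurableT_comp _ _ _ _ _ _ (fun y : vec R d => tnth y k)).
    exact: measurable_tnth.
  exact: measurable_tnth.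
have : measurable ([set: n.-tuple (vec R d)] `&`
    (fun x => tnth (tnth x i) k == tnth (tnth x j) k) @^-1` [set false]).
  exact: (measurable_fun_eqr (mt i) (mt j)).
by rewrite setTI; congr measurable; apply/seteqP; split => x /=;
  [move=> ->|move/negbTE].
Qed.

Let conf_measurable0 : conf_measurable set0.
Proof. by move=> n; rewrite preimage_set0 setI0. Qed.

Let conf_measurableC A : conf_measurable A -> conf_measurable (~` A).
Proof.
move=> mA n; have -> : offdiag (n := n) `&` conf_of (n := n) @^-1` (~` A) =
    offdiag (n := n) `\` (offdiag (n := n) `&` conf_of (n := n) @^-1` A).
  by rewrite setDIr setDv set0U preimage_setC -setDE.
by apply: measurableD; [exact: measurable_offdiag|exact: mA].
Qed.

Let conf_measurableU (F : (set (conf R d))^nat) :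
  (forall i, conf_measurable (F i)) -> conf_measurable (\bigcup_i F i).
Proof.
move=> mF n; rewrite preimage_bigcup setI_bigcupr.
by apply: bigcup_measurable => k _; exact: mF.
Qed.

HB.instance Definition _ := @isMeasurable.Build conf_display (conf R d)
  conf_measurable conf_measurable0 conf_measurableC conf_measurableU.

End conf_measurable.

Section operators.
Context {R : realType} {d : nat}.
Local Notation X := (vec R d).
Local Notation Gamma0 := (conf R d).
Implicit Types (F G : Gamma0 -> R) (eta : Gamma0).

Definition Bbs G :=
  [/\ measurable_fun setT G,
      exists M : R, forall eta, `|G eta| <= M
    & exists N : nat, exists Lambda : set X,
      [/\ measurable Lambda, vbounded Lambda
        & forall eta, ~ ((#|` eta| <= N)%N /\ [set` eta] `<=` Lambda) ->
            G eta = 0]].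

Definition Ktransform G eta : R := \sum_(xi <- fpowerset eta) G xi.

Definition Kinv F eta : R :=
  \sum_(xi <- fpowerset eta) (-1) ^+ #|` (eta `\` xi)%fset| * F xi.

(* The unordered pairs {x1, x2} contained in eta; pt1 p and pt2 p enumerate the
   points of p in an arbitrary order, immaterial for rates symmetric in x1, x2. *)
Definition upairs eta : {fset Gamma0} :=
  [fset p in fpowerset eta | #|` p| == 2]%fset.
Definition pt1 (p : Gamma0) : X := nth point (enum_fset p) 0.
Definition pt2 (p : Gamma0) : X := nth point (enum_fset p) 1.

Variable c : X -> X -> X -> X -> R.

Definition jump_integrand F eta (p : Gamma0) (y : X * X) : R :=
  c (pt1 p) (pt2 p) y.1 y.2 *
  (F ((eta `\` p) `|` [fset y.1; y.2])%fset - F eta).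

Definition jump_gen F eta : R :=
  \sum_(p <- upairs eta) Rintegral (leb \x leb)%E setT (jump_integrand F eta p).

Definition jump_gen_converges F eta :=
  forall p, p \in upairs eta ->
    (leb \x leb)%E.-integrable setT (EFin \o jump_integrand F eta p).

Definition Lhat G : Gamma0 -> R := Kinv (jump_gen (Ktransform G)).

(* Lhat G eta involves the generator applied to KG at every subset of eta; each
   of the integrals occurring there has to converge absolutely. *)
Definition Lhat_converges G eta :=
  forall gamma : Gamma0, (gamma `<=` eta)%fset ->
    jump_gen_converges (Ktransform G) gamma.

(* L_0 is given by the same expression as the generator. *)
Definition L0 G : Gamma0 -> R := jump_gen G.

Definition ctilde (x1 x2 y1 : X) : \bar R := \int[leb]_y2 (c x1 x2 y1 y2)%:E.

Definition W_integrand G eta (x1 x2 y1 : X) : \bar R :=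
  (ctilde x1 x2 y1 *
   (G ((eta `\` [fset x1; x2]) `|` [fset y1])%fset
    - G (eta `\ x2)%fset)%:E)%E.

Definition W G eta : R :=
  \sum_(x2 <- eta) \sum_(x1 <- (eta `\ x2)%fset)
    fine (\int[leb]_y1 W_integrand G eta x1 x2 y1).

Definition W_converges G eta :=
  forall x1 x2, x1 \in eta -> x2 \in eta -> x1 != x2 ->
    leb.-integrable setT (W_integrand G eta x1 x2).

End operators.

(* Main.v *)
(* For a pair p in eta, the subsets of eta containing p are the p \cup xi with
   xi in eta \ p =: zeta, so that (K^-1 L K G)(eta) is the sum over p of the
   integral over y = (y1, y2) of c(p, y) times K^-1 applied, at zeta, to
   KG(. \cup {y1, y2}) - KG(. \cup p).  As K^-1 (KG(. \cup P))(zeta) is the sum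
   of G(zeta \cup q) over q \subset P, for a.e. y the integrand is
     c(p, y) (G(zeta, y1, y2) - G(eta))
     + c(p, y) (G(zeta, y1) - G(zeta, x1)) + c(p, y) (G(zeta, y2) - G(zeta, x2)).
   The first term gives L_0.  Integrating out y2 (resp., by symmetry, y1) in the
   other two replaces c by its marginal and gives W; absolute convergence of the
   W integrals is, by Tonelli, integrability of these terms on the product. *)
Require Import Defs.
From mathcomp Require Import all_boot all_order all_algebra finmap.
From mathcomp Require Import all_classical all_reals all_analysis.
From mathcomp Require Import measurable_realfun ring.
Set Implicit Arguments.
Unset Strict Implicit.
Unset Printing Implicit Defensive.
Import Order.TTheory GRing.Theory Num.Theory.
Import numFieldNormedType.Exports.
Local Open Scope classical_set_scope.
Local Open Scope ring_scope.

(** * Sums over power sets; [Ktransform] and [Kinv] *)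

(** A subset of the enlarged set either misses [x] or comes from a unique subset of [A] by adding
    [x]; removing [x] again gives uniqueness. *)
Lemma big_fpowersetU1 (K : choiceType) (V : nmodType) (x : K) (A : {fset K})
    (F : {fset K} -> V) : x \notin A ->
  \sum_(B <- fpowerset (x |` A)%fset) F B =
  \sum_(B <- fpowerset A) F B + \sum_(B <- fpowerset A) F (x |` B)%fset.
Proof.
move=> xA; have xB B : (B `<=` A)%fset -> x \notin B.
  by move=> /fsubsetP BA; apply: contra xA => /BA.
rewrite -[X in _ + X](big_map (fun B => x |` B)%fset xpredT) -big_cat /=.
apply: perm_big; apply: uniq_perm => [||B].
- exact: fset_uniq.
- rewrite cat_uniq fset_uniq /=; apply/andP; split.
    apply/hasPn => C /mapP[B]; rewrite !fpowersetE => /xB xB' ->.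
    by apply: contra xA => /fsubsetP; apply; rewrite fset1U1.
  rewrite map_inj_in_uniq ?fset_uniq// => B C.
  rewrite !fpowersetE => /xB xB' /xB xC BC.
  by rewrite -(fsetU1K xB') BC fsetU1K.
- rewrite mem_cat !fpowersetE; apply/idP/orP => [BxA|[BA|/mapP[C]]].
  + have [xinB|xNB] := boolP (x \in B); last first.
      left; apply/fsubsetP => y yB; have /fset1UP[yx|//] := fsubsetP BxA _ yB.
      by rewrite -yx yB in xNB.
    right; apply/mapP; exists (B `\ x)%fset; last by rewrite fsetD1K.
    by rewrite fpowersetE fsubDset.
  + exact: fsubset_trans BA (fsubsetU1 _ _).
  + by rewrite fpowersetE => CA ->; exact: fsetUS.
Qed.

Section combinatorics.
Context {R : realType} {d : nat}.
Implicit Types (F G : conf R d -> R) (eta zeta P p : conf R d).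

Lemma KtransformU1 G (x : vec R d) eta : x \notin eta ->
  Ktransform G (x |` eta)%fset =
  Ktransform G eta + Ktransform (fun xi => G (x |` xi)%fset) eta.
Proof. by move=> xeta; rewrite /Ktransform big_fpowersetU1. Qed.

Lemma eq_Kinv F G zeta : (forall xi, (xi `<=` zeta)%fset -> F xi = G xi) ->
  Kinv F zeta = Kinv G zeta.
Proof.
move=> FG; rewrite /Kinv !big_seq; apply: eq_bigr => xi.
by rewrite fpowersetE => /FG ->.
Qed.

(** Leaving [x] out costs one more factor -1, so [Kinv] is an iterated difference, one for each
    point. *)
Lemma KinvU1 F (x : vec R d) zeta : x \notin zeta ->
  Kinv F (x |` zeta)%fset = Kinv (fun xi => F (x |` xi)%fset - F xi) zeta.
Proof.
move=> xz; rewrite /Kinv big_fpowersetU1// -big_split !big_seq.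
apply: eq_bigr => xi; rewrite fpowersetE => /fsubsetP xiz.
have xxi : x \notin xi by apply: contra xz => /xiz.
have -> : ((x |` zeta) `\` xi = x |` (zeta `\` xi))%fset.
  by apply/fsetP => y; rewrite !inE; case: eqP => [->|]; rewrite ?xxi.
have -> : ((x |` zeta) `\` (x |` xi) = zeta `\` xi)%fset.
  apply/fsetP => y; rewrite !inE; case: eqP => [->|//].
  by rewrite (negbTE xz) andbF.
rewrite cardfsU1 !inE (negbTE xz) andbF /= exprD expr1.
by rewrite mulN1r mulNr mulrBr addrC.
Qed.

(* Absorbing the points of [zeta] into G one by one commutes with K. *)
Lemma Kinv_KtransformU G zeta P : [disjoint zeta & P]%fset ->
  Kinv (fun xi => Ktransform G (xi `|` P)%fset) zeta =
  Ktransform (fun q => G (zeta `|` q)%fset) P.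
Proof.
elim/fset1U_rect: zeta G => [G _|x zeta xz IH G].
  rewrite /Kinv fpowerset0 big_seq_fset1 fsetD0 cardfs0 expr0 mul1r fset0U.
  by apply: eq_bigr => xi _; rewrite fset0U.
rewrite fdisjointU1X => /andP[xP zP]; rewrite KinvU1//.
(* As [x] lies in neither [xi] nor [P], the difference in [x] is the transform of [G] with [x]
   absorbed; hence the induction is over all [G]. *)
transitivity (Kinv (fun xi =>
    Ktransform (fun q => G (x |` q)%fset) (xi `|` P)%fset) zeta).
  apply: eq_Kinv => xi /fsubsetP xiz.
  rewrite -fsetUA KtransformU1 1?[LHS]addrAC ?subrr ?add0r//.
  by rewrite inE negb_or xP andbT; apply: contra xz => /xiz.
by rewrite IH//; apply: eq_bigr => q _; rewrite fsetUA.
Qed.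

Lemma Ktransform_pair G (a b : vec R d) : a != b ->
  Ktransform G [fset a; b]%fset =
  G fset0 + G [fset a]%fset + G [fset b]%fset + G [fset a; b]%fset.
Proof.
move=> ab; rewrite KtransformU1 ?inE// /Ktransform !fpowerset1.
rewrite !big_fsetU1 ?inE ?big_seq_fset1 /=;
  try by rewrite eq_sym -cardfs_eq0 cardfs1.
by rewrite fsetU0; ring.
Qed.

(** * Unordered pairs and reindexing of sums *)

Lemma in_upairs p eta : (p \in upairs eta) = (p `<=` eta)%fset && (#|` p| == 2).
Proof. by rewrite !inE fpowersetE. Qed.

Lemma upairE p eta : p \in upairs eta ->
  pt1 p != pt2 p /\ p = [fset pt1 p; pt2 p]%fset.
Proof.
rewrite in_upairs => /andP[_ /eqP p2].
have : uniq (enum_fset p) by exact: fset_uniq.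
have pE x : (x \in p) = (x \in enum_fset p) by [].
move: pE p2; rewrite /pt1 /pt2; case: (enum_fset p) => [|a [|b [|]]]//= pE _.
rewrite inE => /andP[ab _]; split => //.
by apply/fsetP => x; rewrite pE !inE.
Qed.

Lemma upairs_subset p gamma eta : (gamma `<=` eta)%fset ->
  (p \in upairs gamma) = (p \in upairs eta) && (p `<=` gamma)%fset.
Proof.
move=> ge; rewrite !in_upairs.
have [pg|_] := boolP (p `<=` gamma)%fset; last by rewrite andbF.
by rewrite (fsubset_trans pg ge) andbT.
Qed.

(** The two sums are exchanged. Signs are kept because removing the union of [xi] and [p] from [eta]
    amounts to removing first [p], then [xi]. *)
Lemma Kinv_sum_upairs (I : conf R d -> conf R d -> R) eta :
  Kinv (fun gamma => \sum_(p <- upairs gamma) I gamma p) eta =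
  \sum_(p <- upairs eta) Kinv (fun xi => I (xi `|` p)%fset p) (eta `\` p)%fset.
Proof.
rewrite /Kinv; under eq_bigr do rewrite mulr_sumr.
(* The inner index set now depends on [gamma] only through a filter, as the exchange requires. *)
transitivity (\sum_(gamma <- fpowerset eta)
    \sum_(p <- upairs eta | (p `<=` gamma)%fset)
      (-1) ^+ #|` (eta `\` gamma)%fset| * I gamma p).
  rewrite big_seq [RHS]big_seq; apply: eq_bigr => gamma; rewrite fpowersetE => ge.
  rewrite -[RHS]big_filter; apply: perm_big; apply: uniq_perm => [||p].
  - exact: fset_uniq.
  - by rewrite filter_uniq// fset_uniq.
  - by rewrite mem_filter (upairs_subset _ ge) andbC.
rewrite (exchange_big_dep xpredT)//= big_seq [RHS]big_seq.
apply: eq_bigr => p; rewrite in_upairs => /andP[pe _].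
rewrite -[LHS]big_filter.
transitivity (\sum_(gamma <-
      [seq (xi `|` p)%fset | xi <- fpowerset (eta `\` p)%fset])
    (-1) ^+ #|` (eta `\` gamma)%fset| * I gamma p).
  apply: perm_big; apply: uniq_perm => [||gamma].
  - by rewrite filter_uniq// fset_uniq.
  - rewrite map_inj_in_uniq ?fset_uniq// => A B.
    rewrite !fpowersetCE => /andP[_ Ap] /andP[_ Bp] AB.
    have DU (C : conf R d) : [disjoint C & p]%fset -> ((C `|` p) `\` p = C)%fset.
      by move=> Cp; rewrite fsetDUl fsetDv fsetU0; exact/fsetDidPl.
    by rewrite -(DU A)// AB DU.
  - rewrite mem_filter fpowersetE; apply/andP/mapP => [[pg ge]|[xi]].
      exists (gamma `\` p)%fset; first by rewrite fpowersetE fsetSD.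
      by rewrite fsetUDr fsetDv fsetD0; apply/esym/fsetUidPl.
    rewrite fpowersetE => xie ->; rewrite fsubsetUr fsubUset pe andbT; split => //.
    exact: fsubset_trans xie (fsubsetDl _ _).
by rewrite big_map; apply: eq_bigr => xi _; rewrite fsetDDl fsetUC.
Qed.

(** Both orders of each pair occur on the right, so the arbitrary enumeration by [pt1] and [pt2] is
    harmless even for a non-symmetric [w]. *)
Lemma sum_upairs (w : vec R d -> vec R d -> R) eta :
  \sum_(x2 <- eta) \sum_(x1 <- (eta `\ x2)%fset) w x1 x2 =
  \sum_(p <- upairs eta) (w (pt1 p) (pt2 p) + w (pt2 p) (pt1 p)).
Proof.
pose s1 := [seq (x1, x2) | x2 <- eta, x1 <- (eta `\ x2)%fset].
pose s2 := [seq (pt1 p, pt2 p) | p <- upairs eta] ++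
  [seq (pt2 p, pt1 p) | p <- upairs eta].
transitivity (\sum_(z <- s1) w z.1 z.2).
  by rewrite /s1 big_allpairs_dep.
transitivity (\sum_(z <- s2) w z.1 z.2); last first.
  by rewrite /s2 big_cat !big_map big_split.
apply: perm_big; apply: uniq_perm => [||[a b]].
- apply: allpairs_uniq_dep => [||z1 z2 _ _]; first exact: fset_uniq.
    by move=> x _; exact: fset_uniq.
  by case: z1 => a1 b1; case: z2 => a2 b2 /= [-> ->].
- rewrite cat_uniq !map_inj_in_uniq ?fset_uniq ?andbT /=.
  (* An entry common to both halves would come from a single pair whose two points coincide. *)
  + apply/hasPn => z /mapP[q qe ->]; apply/mapP => -[p pe [qp1 qp2]].
    have [pp pE] := upairE pe; have [qq qE] := upairE qe.
    have pq : p = q by rewrite pE qE -qp1 -qp2 fsetUC.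
    by rewrite pq in qp1; rewrite qp1 eqxx in qq.
  + by move=> p q /upairE[_ pE] /upairE[_ qE] [e1 e2]; rewrite pE qE e1 e2.
  + by move=> p q /upairE[_ pE] /upairE[_ qE] [e1 e2]; rewrite pE qE e1 e2.
- rewrite mem_cat; apply/allpairsPdep/orP => [[x2 [x1 [x2e]]]|].
    rewrite !inE => /andP[x12 x1e] [-> ->].
    have pe : [fset x1; x2]%fset \in upairs eta.
      by rewrite in_upairs fsubUset !fsub1set x1e x2e cardfs2 x12.
    have [pp pE] := upairE pe.
    (* The enumeration lists either x1, x2 or x2, x1; these cases land in the first and the second
       half of [s2]. *)
    set p := [fset x1; x2]%fset in pe pp pE.
    have xp x : x \in p -> x = pt1 p \/ x = pt2 p.
      by rewrite {1}pE !inE => /orP[]/eqP; [left|right].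
    have [|e1|e1] := xp x1; first by rewrite !inE eqxx.
    + have [|e2|e2] := xp x2; first by rewrite !inE eqxx orbT.
        by move: x12; rewrite [X in X != _]e1 [X in _ != X]e2 eqxx.
      by left; apply/mapP; exists p => //; congr pair.
    + have [|e2|e2] := xp x2; first by rewrite !inE eqxx orbT.
        by right; apply/mapP; exists p => //; congr pair.
      by move: x12; rewrite [X in X != _]e1 [X in _ != X]e2 eqxx.
  have pin p : p \in upairs eta -> pt1 p \in eta /\ pt2 p \in eta.
    move=> pe; have [_ pE] := upairE pe.
    move: pe; rewrite in_upairs => /andP[/fsubsetP pe _].
    by split; apply: pe; rewrite [X in _ \in X]pE !inE eqxx ?orbT.
  by move=> -[] /mapP[p pe [-> ->]]; have [] := pin _ pe;
    have [pp _] := upairE pe; eexists; eexists; split; rewrite ?inE //;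
    rewrite ?pp ?(eq_sym (pt2 p)) ?pp; eauto.
Qed.

End combinatorics.

(** * Tonelli and Fubini with a nonnegative kernel *)

Section fubini.
Local Open Scope ereal_scope.
Context d1 d2 (T1 : measurableType d1) (T2 : measurableType d2) (R : realType).
Variable m1 : {sigma_finite_measure set T1 -> \bar R}.
Variable m2 : {sigma_finite_measure set T2 -> \bar R}.

(** The integral of [f] may be infinite, so a negative [a] is treated through [- a], the sign being
    pulled out of the integral of a nonnegative function. *)
Lemma ge0_integralZr_EFin (f : T2 -> R) (a : R) :
  (forall y, (0 <= f y)%R) -> measurable_fun setT f ->
  \int[m2]_y (f y * a)%:E = \int[m2]_y (f y)%:E * a%:E.
Proof.
move=> f0 mf; have mf' : measurable_fun setT (EFin \o f) by exact/measurable_EFinP.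
have pos (b : R) : (0 <= b)%R ->
    \int[m2]_y (f y * b)%:E = \int[m2]_y (f y)%:E * b%:E.
  move=> b0; under eq_integral do rewrite EFinM.
  by rewrite ge0_integralZr// => y _; rewrite lee_fin.
have [a0|a0] := leP 0%R a; first exact: pos.
have Na0 : (0 <= - a)%R by rewrite oppr_ge0 ltW.
rewrite -[in RHS](opprK a) EFinN muleN -pos// -integral_ge0N.
  by apply: eq_integral => y _; rewrite -EFinN mulrN opprK.
by move=> y _; rewrite lee_fin mulr_ge0.
Qed.

(** Integrability on either product is finiteness of one and the same iterated integral of the
    absolute value; the two integrals likewise share an iterated form. *)
Lemma integrable_swap (f : T1 * T2 -> \bar R) :
  (m1 \x m2).-integrable setT f ->
  (m2 \x m1).-integrable setT (fun z => f (z.2, z.1)) /\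
  \int[m2 \x m1]_z f (z.2, z.1) = \int[m1 \x m2]_z f z.
Proof.
move=> fi; have mf := measurable_int _ fi.
have mfs : measurable_fun setT (fun z : T2 * T1 => f (z.2, z.1)).
  by apply: (measurableT_comp mf); exact: measurable_fun_pair.
have fsi : (m2 \x m1).-integrable setT (fun z => f (z.2, z.1)).
  by apply/(integrable21ltyP _ _ mfs); exact/(integrable12ltyP _ _ mf).
by split=> //; rewrite -(integral21_prod_meas1 fsi) -(integral12_prod_meas1 fi).
Qed.

(** Since [k] is nonnegative, the inner integral of the absolute value of the product is the
    absolute value of [h] times the marginal of [k]. Tonelli then gives integrability on the
    product, and Fubini the value. *)
Lemma integrable_kernelM (k : T1 * T2 -> R) (h : T1 -> R) :
  (forall z, (0 <= k z)%R) -> measurable_fun setT k -> measurable_fun setT h ->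
  m1.-integrable setT (fun x => \int[m2]_y (k (x, y))%:E * (h x)%:E) ->
  (m1 \x m2).-integrable setT (fun z => (k z * h z.1)%:E) /\
  \int[m1 \x m2]_z (k z * h z.1)%:E =
    \int[m1]_x (\int[m2]_y (k (x, y))%:E * (h x)%:E).
Proof.
move=> k0 mk mh hi.
have mkx x : measurable_fun setT (fun y => k (x, y)) by exact: measurableT_comp.
have mkh : measurable_fun setT (fun z : T1 * T2 => (k z * h z.1)%:E).
  by apply/measurable_EFinP; apply: measurable_funM => //; exact: measurableT_comp.
have khi : (m1 \x m2).-integrable setT (fun z => (k z * h z.1)%:E).
  apply/(integrable12ltyP _ _ mkh); move/integrableP : hi => [_].
  congr (_ < _); apply: eq_integral => x _.
  rewrite abseM (gee0_abs (integral_ge0 _ _)) => [|y _]; last by rewrite lee_fin.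
  rewrite -ge0_integralZr_EFin//; apply: eq_integral => y _ /=.
  by rewrite normrM (ger0_norm (k0 _)).
split=> //; rewrite -(integral12_prod_meas1 khi); apply: eq_integral => x _.
by have := ge0_integralZr_EFin (h x) _ (mkx x); exact.
Qed.

End fubini.

(** * Measurability for points and configurations *)

Section vec_measure.
Context {R : realType} {d : nat}.
Local Notation X := (vec R d).

Lemma measurable_vec_set1 (a : X) : measurable [set a].
Proof.
have -> : [set a] = \bigcap_(i in [set: 'I_d]) [set x : X | tnth x i = tnth a i].
  apply/seteqP; split => [x -> //|x /= H].
  by apply/eq_from_tnth => i; exact: H.
apply: fin_bigcap_measurable => // i _.
have := @measurable_tnth _ (measurableTypeR R) d i measurableT _
  (measurable_set1 (tnth a i)).
by rewrite setTI.
Qed.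

Lemma measurable_vec_diag : measurable [set z : X * X | z.1 = z.2].
Proof.
have -> : [set z : X * X | z.1 = z.2] =
    \bigcap_(i in [set: 'I_d]) [set z : X * X | tnth z.1 i = tnth z.2 i].
  apply/seteqP; split => [z /= zE i _ /=|z /= H]; first by rewrite zE.
  by apply/eq_from_tnth => i; exact: H.
apply: fin_bigcap_measurable => // i _.
have : measurable ([set: X * X] `&`
    (fun z => (tnth z.1 i : R) == tnth z.2 i) @^-1` [set true]).
  apply: measurable_fun_eqr => //.
  - by apply: (measurableT_comp (measurable_tnth i)).
  - by apply: (measurableT_comp (measurable_tnth i)).
by rewrite setTI; congr measurable; apply/seteqP; split => z /= /eqP.
Qed.

(** Measurability of sets of configurations is tested on tuples of distinct points. For y outside
    [zeta], prefixing y to an enumeration of [zeta] gives such a tuple; the remaining y form a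
    finite set. *)
Lemma measurable_conf_fset1U (zeta : conf R d) :
  measurable_fun setT (fun y : X => (y |` zeta)%fset : conf R d).
Proof.
move=> _ A mA; rewrite setTI.
pose n := size (enum_fset zeta).
pose phi (y : X) : n.+1.-tuple X := [tuple of y :: in_tuple (enum_fset zeta)].
have mphi : measurable_fun setT phi.
  by apply: (measurable_cons (f := id) (g := cst (in_tuple (enum_fset zeta)))).
have -> : (fun y : X => (y |` zeta)%fset) @^-1` A =
    (phi @^-1` (@offdiag R d n.+1 `&` @conf_of R d n.+1 @^-1` A)) `|`
    \bigcup_(y in [set` zeta] `&` (fun y : X => (y |` zeta)%fset) @^-1` A) [set y].
  rewrite bigcup_imset1 image_id.
  have conf_phi y : conf_of (phi y) = (y |` zeta)%fset.
    by apply/fsetP => x; rewrite !inE.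
  apply/seteqP; split => [y /= Ay|y /= [[_ ]|[]//]]; last by rewrite conf_phi.
  have [yz|yz] := boolP (y \in zeta); first by right.
  left; split; last by rewrite conf_phi.
  by rewrite /offdiag/= fset_uniq andbT.
apply: measurableU.
  by rewrite -[X in measurable X]setTI; exact: (mphi measurableT _ (mA n.+1)).
apply: fin_bigcup_measurable => [|y _]; last exact: measurable_vec_set1.
exact: finite_setIl (finite_fset zeta).
Qed.

End vec_measure.

(** * Null sets in positive dimension *)

Section null_sets.
Context {R : realType} {d : nat}.
Hypothesis d_gt0 : (0 < d)%N.
Local Notation X := (vec R d).
Local Open Scope ereal_scope.

(** Positive dimension enters here: in dimension 0 [leb] is a Dirac mass. Otherwise the first factor
    of a point is null on the line. *)
Lemma leb_set1 (a : X) : leb [set a] = 0.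
Proof.
case: d d_gt0 a => // n _ a.
rewrite /leb -/leb /pushforward.
have -> : @consv R n @^-1` [set a] = [set thead a] `*` [set [tuple of behead a]].
  apply/seteqP; split => [[x t]|[x t]] /=.
    by move=> <-; split; [rewrite theadE|exact/val_inj].
  by move=> [-> ->]; rewrite /consv /= -tuple_eta.
rewrite product_measure1E//; last exact: measurable_vec_set1.
by rewrite [X in X * _](lebesgue_measure_set1 (thead a : R)) mul0e.
Qed.

(** The exceptional set is a finite union of products with a one-point factor, together with the
    diagonal, whose sections are points. *)
Lemma ae_generic_pair (zeta : conf R d) :
  {ae leb \x leb, forall y : X * X,
     [/\ y.1 != y.2, y.1 \notin zeta & y.2 \notin zeta]}.
Proof.
pose m : {sigma_finite_measure set X -> \bar R} := leb.
have fst_ae (a : X) : {ae m \x m, forall y : X * X, y.1 != a}.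
  exists ([set a] `*` setT); split.
  - by apply: measurableX => //; exact: measurable_vec_set1.
  - rewrite product_measure1E//; last exact: measurable_vec_set1.
    by rewrite [X in X * _]leb_set1 mul0e.
  - by move=> y /= /negP; rewrite negbK => /eqP.
have snd_ae (a : X) : {ae m \x m, forall y : X * X, y.2 != a}.
  exists (setT `*` [set a]); split.
  - by apply: measurableX => //; exact: measurable_vec_set1.
  - rewrite product_measure1E//; last exact: measurable_vec_set1.
    by rewrite [X in _ * X]leb_set1 mule0.
  - by move=> y /= /negP; rewrite negbK => /eqP.
(* [f] stands for either projection; the induction adds one null set per point of [zeta]. *)
have notin_ae (f : X * X -> X) :
    (forall a, {ae m \x m, forall y, f y != a}) ->
    {ae m \x m, forall y, f y \notin zeta}.
  move=> fa; suff : {ae m \x m, forall y, f y \notin enum_fset zeta} by [].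
  elim: (enum_fset zeta) => [|a s IH]; first exact: aeW.
  by move: IH; apply: filterS2 (fa a) => y ya ys; rewrite inE negb_or ya.
have diag_ae : {ae m \x m, forall y : X * X, y.1 != y.2}.
  exists [set y | y.1 = y.2]; split; first exact: measurable_vec_diag.
  - rewrite /product_measure1 integral0_eq// => x _ /=.
    rewrite (_ : xsection _ _ = [set x]) ?[LHS]leb_set1//.
    by apply/seteqP; split => y; rewrite /xsection /= inE /= => ->.
  - by move=> y /= /negP; rewrite negbK => /eqP.
by apply: filterS3 diag_ae (notin_ae _ fst_ae) (notin_ae _ snd_ae).
Qed.

End null_sets.

(** Serves to move [Kinv], a finite signed sum, under the integral. *)
Lemma Rintegral_lincomb (R : realType) (dT : measure_display)
    (T : measurableType dT) (mu : {measure set T -> \bar R}) (I : eqType)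
    (s : seq I) (a : I -> R) (F : I -> T -> R) :
  {in s, forall i, mu.-integrable setT (EFin \o F i)} ->
  mu.-integrable setT (EFin \o (fun y => \sum_(i <- s) a i * F i y)) /\
  Rintegral mu setT (fun y => \sum_(i <- s) a i * F i y) =
    \sum_(i <- s) a i * Rintegral mu setT (F i).
Proof.
elim: s => [_|i s IH Fi].
  rewrite big_nil (_ : (fun _ => _) = cst 0); last first.
    by apply/funext => y; rewrite big_nil.
  split; first exact: integrable0.
  by rewrite /Rintegral integral0_eq.
have [|IHi IHE] := IH; first by move=> j js; apply: Fi; rewrite inE js orbT.
have Fii : mu.-integrable setT (EFin \o F i) by apply: Fi; rewrite inE eqxx.
have aFi : mu.-integrable setT (EFin \o (fun y => a i * F i y)).
  exact: (integrableZl measurableT (a i) Fii).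
rewrite big_cons -IHE -RintegralZl// -RintegralD//.
under eq_fun do rewrite big_cons.
by split=> //; exact: (integrableD measurableT aFi IHi).
Qed.

(** * Contribution of a single pair *)

Section pair.
Context {R : realType} {d : nat}.
Local Notation X := (vec R d).
Variables (c : X -> X -> X -> X -> R) (G : conf R d -> R).
Local Notation m := (leb \x leb)%E.

(** [eta] without x2 is [x1] joined to [eta] without both points, so both values of [G] take the
    form of one point added to a common configuration. *)
Lemma W_integrandE eta (x1 x2 y1 : X) :
  x1 \in eta -> x1 != x2 ->
  W_integrand c G eta x1 x2 y1 =
  (ctilde c x1 x2 y1 * (G (y1 |` (eta `\` [fset x1; x2]))%fset
     - G (x1 |` (eta `\` [fset x1; x2]))%fset)%:E)%E.
Proof.
move=> x1e x12; rewrite /W_integrand fsetUC; congr (_ * (_ - G _)%:E)%E.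
apply/fsetP => x; rewrite !inE; case: (eqVneq x x1) => [->|]//=.
by rewrite x12 x1e.
Qed.

(* The exceptional null set is where the points of y collide with each other or
   with eta \ p. *)
Lemma Kinv_jump_integrand eta p (y : X * X) : p \in upairs eta ->
  y.1 != y.2 -> y.1 \notin (eta `\` p)%fset -> y.2 \notin (eta `\` p)%fset ->
  Kinv (fun xi => jump_integrand c (Ktransform G) (xi `|` p)%fset p y)
    (eta `\` p)%fset =
  jump_integrand c G eta p y +
  (c (pt1 p) (pt2 p) y.1 y.2 *
    (G (y.1 |` (eta `\` p))%fset - G (pt1 p |` (eta `\` p))%fset) +
   c (pt1 p) (pt2 p) y.1 y.2 *
    (G (y.2 |` (eta `\` p))%fset - G (pt2 p |` (eta `\` p))%fset)).
Proof.
move=> pe y12 y1e y2e; have [pt12 pE] := upairE pe.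
set zeta := (eta `\` p)%fset in y1e y2e *; rewrite /jump_integrand.
set k := c _ _ _ _.
have zp : [disjoint zeta & p]%fset.
  by have := fsubset_refl zeta; rewrite {2}/zeta fsubsetD => /andP[].
have zy : [disjoint zeta & [fset y.1; y.2]]%fset.
  by rewrite fdisjointXU !fdisjointX1 y1e y2e.
(* The rate depends only on [p] and [y], so it leaves [Kinv]; as [xi] is disjoint from [p], removing
   [p] from their union gives back [xi]. *)
transitivity (k * (Kinv (fun xi => Ktransform G (xi `|` [fset y.1; y.2])%fset) zeta
    - Kinv (fun xi => Ktransform G (xi `|` p)%fset) zeta)).
  rewrite /Kinv -sumrB mulr_sumr !big_seq; apply: eq_bigr => xi.
  rewrite fpowersetE fsubsetD => /andP[_ xip].
  have -> : ((xi `|` p) `\` p = xi)%fset.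
    by rewrite fsetDUl fsetDv fsetU0; exact/fsetDidPl.
  by rewrite -mulrBr mulrCA.
(* Each transform expands over the four subsets of a pair. The empty subset contributes the same
   term to both and cancels; all of [p] contributes [G eta]. *)
rewrite !Kinv_KtransformU// [in X in _ * (_ - X)]pE !Ktransform_pair// -pE.
have -> : (zeta `|` p = eta)%fset.
  rewrite /zeta fsetUDr fsetDv fsetD0; apply/fsetUidPl.
  by move: pe; rewrite in_upairs => /andP[].
by rewrite fsetU0 ![(zeta `|` [fset _])%fset]fsetUC; ring.
Qed.

(** All integrals, those of [W] included, are lifted to the product space, where the pointwise
    identity holds almost everywhere. *)
Lemma Kinv_jump_pair eta p : (0 < d)%N ->
  (forall x1 x2 y1 y2, 0 <= c x1 x2 y1 y2) ->
  (forall x1 x2, measurable_fun setT (fun y : X * X => c x1 x2 y.1 y.2)) ->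
  (forall x1 x2 y1 y2, c x1 x2 y1 y2 = c x2 x1 y1 y2) ->
  (forall x1 x2 y1 y2, c x1 x2 y1 y2 = c x1 x2 y2 y1) ->
  measurable_fun setT G ->
  Lhat_converges c G eta -> jump_gen_converges c G eta -> W_converges c G eta ->
  p \in upairs eta ->
  Kinv (fun xi =>
      Rintegral m setT (jump_integrand c (Ktransform G) (xi `|` p)%fset p))
    (eta `\` p)%fset =
  Rintegral m setT (jump_integrand c G eta p) +
  (fine (\int[leb]_y1 W_integrand c G eta (pt1 p) (pt2 p) y1) +
   fine (\int[leb]_y1 W_integrand c G eta (pt2 p) (pt1 p) y1)).
Proof.
move=> d_gt0 c0 mc cx cy mG Lc L0c Wc pe.
have [pt12 pE] := upairE pe.
have [ps _] := andP (etrans (esym (in_upairs _ _)) pe).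
set zeta := (eta `\` p)%fset; set x1 := pt1 p; set x2 := pt2 p.
have x1e : x1 \in eta by apply: (fsubsetP ps); rewrite [X in _ \in X]pE !inE eqxx.
have x2e : x2 \in eta.
  by apply: (fsubsetP ps); rewrite [X in _ \in X]pE !inE eqxx orbT.
(* The replacement of x by y next to [zeta] involves one new point only, so the other can be
   integrated out. *)
pose h x y := G (y |` zeta)%fset - G (x |` zeta)%fset.
have mh x : measurable_fun setT (h x).
  apply: measurable_funB => //.
  exact: (measurableT_comp mG (measurable_conf_fset1U _)).
pose k (y : X * X) := c x1 x2 y.1 y.2.
have k0 y : 0 <= k y by exact: c0.
have mk : measurable_fun setT k by exact: mc.
have ctE y1 : ctilde c x2 x1 y1 = ctilde c x1 x2 y1.
  by apply: eq_integral => y2 _; rewrite cx.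
have W1 y1 : W_integrand c G eta x1 x2 y1 =
    (\int[leb]_y2 (k (y1, y2))%:E * (h x1 y1)%:E)%E.
  by rewrite W_integrandE// -pE.
have W2 y1 : W_integrand c G eta x2 x1 y1 =
    (\int[leb]_y2 (k (y1, y2))%:E * (h x2 y1)%:E)%E.
  by rewrite W_integrandE ?(eq_sym x2)// ctE [[fset x2; x1]%fset]fsetUC -pE.
have [i1 I1] : m.-integrable setT (fun y => (k y * h x1 y.1)%:E) /\
    (\int[m]_y (k y * h x1 y.1)%:E =
     \int[leb]_y1 W_integrand c G eta x1 x2 y1)%E.
  have := Wc _ _ x1e x2e pt12; rewrite (funext W1).
  exact: integrable_kernelM.
have [i2 I2] : m.-integrable setT (fun y => (k y * h x2 y.2)%:E) /\
    (\int[m]_y (k y * h x2 y.2)%:E =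
     \int[leb]_y1 W_integrand c G eta x2 x1 y1)%E.
  have : leb.-integrable setT (W_integrand c G eta x2 x1).
    by apply: Wc => //; rewrite eq_sym.
  (* The factor [h x2] has to be read in the second coordinate: the coordinates are swapped, and
     symmetry of [c] in its last two arguments restores [k]. *)
  rewrite (funext W2) => /integrable_kernelM[//|//|//|i I].
  have [si sI] := integrable_swap i; split; last first.
    rewrite -I -sI; apply: eq_integral => y _ /=.
    by congr (_ * _)%:E; rewrite /k/= cy.
  apply: eq_integrable si => //= y _.
  by congr (_ * _)%:E; rewrite /k/= cy.
have Li xi : (xi `<=` zeta)%fset ->
    m.-integrable setT (EFin \o jump_integrand c (Ktransform G) (xi `|` p)%fset p).
  move=> xz; have xpe : (xi `|` p `<=` eta)%fset.
    by rewrite fsubUset ps andbT (fsubset_trans xz)// fsubsetDl.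
  by apply: (Lc _ xpe); rewrite (upairs_subset _ xpe) pe fsubsetUr.
have [Ki KE] := @Rintegral_lincomb _ _ _ m _ (fpowerset zeta)
  (fun xi => (-1) ^+ #|` (zeta `\` xi)%fset|)
  (fun xi => jump_integrand c (Ktransform G) (xi `|` p)%fset p)
  (fun xi xz => Li xi (etrans (esym (fpowersetE _ _)) xz)).
rewrite [LHS](esym KE).
have i0 : m.-integrable setT (EFin \o jump_integrand c G eta p) by exact: L0c.
have i12 := integrableD measurableT i1 i2.
have i12' : m.-integrable setT
    (EFin \o (fun y => k y * h x1 y.1 + k y * h x2 y.2)) by exact: i12.
(* The right side becomes one real integral, so equality of the integrands almost everywhere
   suffices. *)
rewrite -I1 -I2 -!/(Rintegral _ _ _) -RintegralD// -RintegralD//.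
rewrite /Rintegral; congr fine; apply: ae_eq_integral => //.
- exact: measurable_int Ki.
- exact: measurable_int (integrableD measurableT i0 i12').
- apply: filterS (ae_generic_pair d_gt0 zeta) => y [y12 y1z y2z] _ /=.
  by rewrite -Kinv_jump_integrand.
Qed.

End pair.

Theorem proposition3p1 (R : realType) (d : nat) (d_gt0 : (0 < d)%N)
  (c : vec R d -> vec R d -> vec R d -> vec R d -> R)
  (c_ge0 : forall x1 x2 y1 y2, 0 <= c x1 x2 y1 y2)
  (c_meas : measurable_fun setT
     (fun z : (vec R d * vec R d) * (vec R d * vec R d) =>
        c z.1.1 z.1.2 z.2.1 z.2.2))
  (c_symx : forall x1 x2 y1 y2, c x1 x2 y1 y2 = c x2 x1 y1 y2)
  (c_symy : forall x1 x2 y1 y2, c x1 x2 y1 y2 = c x1 x2 y2 y1)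
  (c_loc : {ae (leb \x leb)%E, forall x : vec R d * vec R d,
     forall Lambda : set (vec R d), measurable Lambda -> vbounded Lambda ->
       (leb \x leb)%E.-integrable (Lambda `*` Lambda)
         (fun y => (c x.1 x.2 y.1 y.2)%:E)})
  (ctilde_fin : {ae ((leb \x leb) \x leb)%E,
     forall z : (vec R d * vec R d) * vec R d,
       (ctilde c z.1.1 z.1.2 z.2 < +oo)%E})
  (G : conf R d -> R) (G_Bbs : Bbs G) (eta : conf R d)
  (Lhat_cvg : Lhat_converges c G eta)
  (L0_cvg : jump_gen_converges c G eta)
  (W_cvg : W_converges c G eta) :
  Lhat c G eta = L0 c G eta + W c G eta.
Proof.
have mc x1 x2 : measurable_fun setT (fun y : vec R d * vec R d =>
    c x1 x2 y.1 y.2) by exact: (measurableT_comp c_meas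
      (measurable_pair1 (x1, x2))).
have [mG _ _] := G_Bbs.
(* Both sides become sums over the pairs of [eta], with [W] giving both orders of each pair; the
   comparison is then pair by pair. *)
rewrite /Lhat Kinv_sum_upairs /L0 /W.
rewrite (sum_upairs (fun x1 x2 => fine (\int[leb]_y1 W_integrand c G eta x1 x2 y1))).
rewrite -big_split big_seq [RHS]big_seq; apply: eq_bigr => p pe.
exact: Kinv_jump_pair.
Qed.
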